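(* Let $K:(0,\infty)^2\to[0,\infty)$ be symmetric and continuous, and $\gamma$-homogeneous with $\gamma>1$, i.e. $K(\lambda x,\lambda y)=\lambda^\gamma K(x,y)$ for all $\lambda,x,y>0$. Assume that $K(1,1)>0$. Then for any $x_0>0$ there exists $r>1$ such that $$\int_{x_0}^\infty [H(a)]^{-1/2}\,\mathrm{d}a<\infty,\qquad\text{where } H(a)=a\,\inf\{K(x,y): x,y\in[a,ra]\}.$$
   Context: Symmetric means $K(x,y)=K(y,x)$ for all $x,y>0$. Convention: $0^{-1/2}=+\infty$. *)

(* Defs.v *)
From HB Require Import structures.
From mathcomp Require Import all_boot all_order all_algebra.
From mathcomp Require Import all_classical all_reals all_analysis.

Set Implicit Arguments.
Unset Strict Implicit.
Unset Printing Implicit Defensive.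

Import Order.TTheory GRing.Theory Num.Theory.
Import numFieldNormedType.Exports.

Local Open Scope classical_set_scope.
Local Open Scope ring_scope.

(* A function K : (0,oo)^2 -> [0,oo) is represented by a total function
   K : R -> R -> R of which only the values at positive arguments matter;
   every predicate below is therefore restricted to positive arguments. *)

Definition nonneg_kernel (R : realType) (K : R -> R -> R) : Prop :=
  forall x y : R, 0 < x -> 0 < y -> 0 <= K x y.

Definition symmetric_kernel (R : realType) (K : R -> R -> R) : Prop :=
  forall x y : R, 0 < x -> 0 < y -> K x y = K y x.

Definition continuous_kernel (R : realType) (K : R -> R -> R) : Prop :=
  {within [set p : R * R | 0 < p.1 /\ 0 < p.2],
    continuous (fun p : R * R => K p.1 p.2)}.

Definition homogeneous_kernel (R : realType) (g : R) (K : R -> R -> R) : Prop :=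
  forall l x y : R, 0 < l -> 0 < x -> 0 < y ->
    K (l * x) (l * y) = l `^ g * K x y.

(* For 0 < a, 1 < r and K nonnegative, the set below is nonempty and bounded
   from below, so that the real-valued [inf] is a genuine infimum. *)
Definition H (R : realType) (K : R -> R -> R) (r a : R) : R :=
  a * inf [set z | exists x y : R,
             [/\ x \in `[a, r * a], y \in `[a, r * a] & z = K x y]].

(* h^(-1/2) for h >= 0, with 0^(-1/2) = +oo; a case distinction is needed since
   the library's power function has 0 `^ p = 0 for every p != 0. *)
Definition rsqrt (R : realType) (h : R) : \bar R :=
  if h == 0 then +oo%E else (h `^ (- 2^-1))%:E.

(* Main.v *)
Require Import Defs.
From mathcomp Require Import all_boot all_order all_algebra.
From mathcomp Require Import all_classical all_reals all_analysis.
From mathcomp Require Import measurable_realfun ring lra.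
Set Implicit Arguments.
Unset Strict Implicit.
Unset Printing Implicit Defensive.
Import Order.TTheory GRing.Theory Num.Theory.
Import numFieldNormedType.Exports.
Local Open Scope classical_set_scope.
Local Open Scope ring_scope.

(** Scaling carries the square [[a, ra]^2] onto [[la, rla]^2], so homogeneity of
    [K] makes [a |-> inf K([a, ra]^2)] homogeneous of degree [gamma], and [H]
    homogeneous of degree [gamma + 1] ([H_homogeneous]):
    [H(a) = a^(gamma+1) H(1)]. Hence the integrand equals
    [H(1)^(-1/2) a^(-(gamma+1)/2)], and as [gamma > 1] the exponent
    [(gamma+1)/2] exceeds 1, which makes the integral converge at infinity
    ([integral_powRN_lty]). The only role of [r] is to ensure [H(1) > 0]: since
    [K] is continuous at [(1,1)] and [K(1,1) > 0], it stays above [K(1,1)/2] on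
    [[1, r]^2] as soon as [r] is close enough to 1 ([H1_gt0]). *)

Definition square_values (R : realType) (K : R -> R -> R) (r a : R) : set R :=
  [set z | exists x y : R,
     [/\ x \in `[a, r * a], y \in `[a, r * a] & z = K x y]].

Lemma square_values_nonempty (R : realType) (K : R -> R -> R) (r a : R) :
  1 <= r -> 0 < a -> square_values K r a !=set0.
Proof.
move=> r1 a0; exists (K a a), a, a.
by rewrite in_itv/= lexx ler_peMl// ltW.
Qed.

Lemma lbound_square_values (R : realType) (K : R -> R -> R) (r a : R) :
  nonneg_kernel K -> 0 < a -> lbound (square_values K r a) 0.
Proof.
move=> K0 a0 _ [x [y [+ + ->]]]; rewrite !in_itv/= => /andP[ax _] /andP[ay _].
by apply: K0; exact: lt_le_trans a0 _.
Qed.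

(** Only one inequality is proved here: applied to [l^-1] it gives the reverse
    one, so that [H_homogeneous] gets an equality from two instances of it. *)
Lemma inf_square_values_scale_le (R : realType) (K : R -> R -> R)
    (g r l a : R) :
  nonneg_kernel K -> homogeneous_kernel g K -> 1 <= r -> 0 < l -> 0 < a ->
  l `^ g * inf (square_values K r a) <= inf (square_values K r (l * a)).
Proof.
move=> K0 Kg r1 l0 a0.
apply: lb_le_inf.
  by apply: square_values_nonempty => //; exact: mulr_gt0.
move=> _ [x [y [+ + ->]]]; rewrite !in_itv/= => /andP[ax xr] /andP[ay yr].
(* Rescaling by l^-1 sends the side of the big square back into [a, r * a]. *)
have scaled z : l * a <= z -> z <= r * (l * a) -> a <= l^-1 * z <= r * a.
  move=> az zr; rewrite ler_pdivlMl// az/= ler_pdivrMl//.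
  by rewrite mulrCA.
have x0 : 0 < x by apply: lt_le_trans ax; exact: mulr_gt0.
have y0 : 0 < y by apply: lt_le_trans ay; exact: mulr_gt0.
have -> : K x y = l `^ g * K (l^-1 * x) (l^-1 * y).
  by rewrite -Kg ?mulr_gt0 ?invr_gt0// !mulVKf// gt_eqF.
rewrite ler_pM2l ?powR_gt0//; apply: ge_inf.
  by exists 0; exact: lbound_square_values.
by exists (l^-1 * x), (l^-1 * y); rewrite !in_itv/= !scaled.
Qed.

(** An exact formula for [H], rather than a lower bound, also gives the
    measurability of the integrand for free. *)
Lemma H_homogeneous (R : realType) (K : R -> R -> R) (g r a : R) :
  nonneg_kernel K -> homogeneous_kernel g K -> 1 <= r -> 0 < a ->
  H K r a = a `^ (g + 1) * H K r 1.
Proof.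
move=> K0 Kg r1 a0.
suff E : inf (square_values K r a) = a `^ g * inf (square_values K r 1).
  rewrite /H -/(square_values K r a) -/(square_values K r 1) E.
  rewrite powRD; last by rewrite (gt_eqF a0) implybT.
  by rewrite powRr1 ?ltW//; ring.
have a'0 : 0 < a^-1 by rewrite invr_gt0.
apply/le_anti/andP; split.
  have := inf_square_values_scale_le K0 Kg r1 a'0 a0.
  rewrite mulVf ?gt_eqF// -(powR_inv1 (ltW a0)) -powRrM mulN1r powRN.
  by rewrite ler_pdivrMl ?powR_gt0.
have := inf_square_values_scale_le K0 Kg r1 a0 ltr01.
by rewrite mulr1.
Qed.

Lemma H1_gt0 (R : realType) (K : R -> R -> R) :
  continuous_kernel K -> 0 < K 1 1 -> exists2 r : R, 1 < r & 0 < H K r 1.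
Proof.
move=> Kc K11.
have : \forall p \near within [set p : R * R | 0 < p.1 /\ 0 < p.2]
    (nbhs ((1, 1) : R * R)), K 1 1 / 2 < K p.1 p.2.
  move/subspace_continuousP: Kc => /(_ (1, 1) (conj ltr01 ltr01)) Kc.
  by apply: (cvgr_gt _ Kc); rewrite ltr_pdivrMr// ltr_pMr// ltr1n.
rewrite /within/= => /nbhs_ballP[e /= e0 He].
have e20 : 0 < e / 2 by rewrite divr_gt0.
(* Halving e turns the open ball of radius e into a closed square inside it. *)
exists (1 + e / 2); first by rewrite ltrDl.
rewrite /H mul1r; apply: (@lt_le_trans _ _ (K 1 1 / 2)); first by rewrite divr_gt0.
apply: lb_le_inf; first by apply: square_values_nonempty; rewrite ?lerDl ?ltW.
move=> _ [x [y [+ + ->]]]; rewrite !in_itv/= !mulr1 => /andP[x1 xr] /andP[y1 yr].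
have near1 z : 1 <= z -> z <= 1 + e / 2 -> ball (1 : R) e z.
  by move=> z1 zr; rewrite /ball/= distrC ger0_norm ?subr_ge0//; lra.
apply/ltW/(He (x, y)) => /=.
  by split; exact: near1.
by split; exact: lt_le_trans ltr01 _.
Qed.

(** Inverting the power function: [x^(-q) < e] as soon as [x > (1/e)^(1/q)]. *)
Lemma cvg_powRN_pinfty (R : realType) (q : R) :
  0 < q -> x `^ (- q) @[x --> +oo] --> (0 : R).
Proof.
move=> q0; apply/cvgr0Pnorm_lt => e e0.
near=> x.
rewrite ger0_norm ?powR_ge0// powRN -[ltRHS]invrK.
rewrite ltf_pV2 ?posrE ?powR_gt0 ?invr_gt0//.
rewrite -[ltLHS]powRr1 ?invr_ge0 ?ltW// -(mulVf (lt0r_neq0 q0)) powRrM.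
by (* What is left is (e^-1)^(q^-1) < x, which holds for all large x. *)
apply: gt0_ltr_powR => //; rewrite nnegrE ?powR_ge0 ?ltW.
Unshelve. all: end_near. Qed.

(** The primitive [x^(1-p) / (1-p)] vanishes at infinity because [1 - p < 0]. *)
Lemma integral_powRN_lty (R : realType) (p b : R) : 1 < p -> 0 < b ->
  (\int[lebesgue_measure]_(x in `[b, +oo[) (x `^ (- p))%:E < +oo)%E.
Proof.
move=> p1 b0.
have p0 : 1 - p != 0 by lra.
pose F (x : R) := (1 - p)^-1 * x `^ (1 - p).
have dF (x : R) : 0 < x -> is_derive x 1 F (x `^ (- p)).
  move=> x0; have := is_derive1_powR (1 - p) x0 => dx.
  have := is_deriveZ (1 - p)^-1 dx.
  by rewrite scalerA mulVf// scale1r addrAC subrr add0r.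
have cF (x : R) : 0 < x -> {for x, continuous F}.
  by move=> x0; apply/differentiable_continuous/derivable1_diffP; case: (dF x x0).
rewrite (@ge0_continuous_FTC2y _ _ F _ 0).
- by rewrite sub0e ltry.
- by move=> x _; exact: powR_ge0.
- apply: derivable_within_continuous => x; rewrite in_itv/= andbT => bx.
  by case: (is_derive1_powR (- p) (lt_le_trans b0 bx)).
- rewrite -(mulr0 (1 - p)^-1); apply: cvgMr.
  by rewrite -opprB; apply: cvg_powRN_pinfty; rewrite subr_gt0.
- by move=> x bx; case: (dF x (lt_trans b0 bx)).
- by apply: cvg_at_right_filter; exact: cF.
- move=> x; rewrite in_itv/= andbT => bx.
  by rewrite derive1E; case: (dF x (lt_trans b0 bx)).
Qed.

(** Positivity of [c] and [a] keeps [rsqrt] away from its infinite value. *)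
Lemma rsqrt_scale_power (R : realType) (c s a : R) : 0 < c -> 0 < a ->
  rsqrt (a `^ s * c) = ((c `^ (- 2^-1))%:E * (a `^ (- (s / 2)))%:E)%E.
Proof.
move=> c0 a0; rewrite /rsqrt gt_eqF ?mulr_gt0 ?powR_gt0//.
by rewrite powRM ?powR_ge0 ?ltW// -powRrM mulrN mulrC EFinM.
Qed.

Theorem mainTheorem2 (R : realType) (K : R -> R -> R) (gamma : R)
    (K_ge0 : nonneg_kernel K)
    (K_sym : symmetric_kernel K)
    (K_cont : continuous_kernel K)
    (gamma_gt1 : 1 < gamma)
    (K_hom : homogeneous_kernel gamma K)
    (K11_gt0 : 0 < K 1 1)
    (x0 : R) (x0_gt0 : 0 < x0) :
  exists r : R, 1 < r /\
    (\int[lebesgue_measure]_(a in `[x0, +oo[) rsqrt (H K r a) < +oo)%E.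
Proof.
have [r r1 Hr0] := H1_gt0 K_cont K11_gt0.
exists r; split => //.
pose p := (gamma + 1) / 2.
have p1 : 1 < p by rewrite /p; lra.
under eq_integral => a.
  rewrite inE/= in_itv/= andbT => x0a.
  have a0 := lt_le_trans x0_gt0 x0a.
  rewrite (H_homogeneous K_ge0 K_hom (ltW r1) a0) rsqrt_scale_power//.
  over.
rewrite ge0_integralZl_EFin ?powR_ge0//.
- by rewrite lte_mul_pinfty ?lee_fin ?powR_ge0// integral_powRN_lty.
- by move=> a _; rewrite lee_fin powR_ge0.
- apply/measurable_EFinP.
  by apply: measurable_funTS; exact: measurable_powR.
Qed.
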